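(* Let $\sigma\ge 0$, $\alpha\ge 0$ be constants and consider the Laplace–Fourier transformed PML model in the two half-planes $y>0$ ($i=1$) and $y<0$ ($i=2$) with piecewise constant orthotropic elastic parameters and the PML interface conditions at $y=0$. If $\mathcal{F}(s,k_x)\neq 0$ for all $s\in\mathbb{C}$ with $\Re s>0$ and all $k_x\in\mathbb{R}$, and the PML Cauchy problem has no temporally growing modes (for the material of each of the two layers), then there are no growing interface wave modes in the PML; that is, $\mathcal{F}(s,\widetilde k_x)\neq0$ for all $s$ with $\Re s>0$ and all $k_x\in\mathbb{R}$, where $\widetilde k_x=k_x/S_x(s)$.
   Context: Notation: $\mathbf{i}=\sqrt{-1}$. For each layer $i=1,2$ the medium has constant density $\rho_i>0$ and constants $c_{11_i},c_{22_i},c_{33_i}>0$, $c_{12_i}\in\mathbb{R}$ with $c_{11_i}c_{22_i}-c_{12_i}^2>0$, and $$A_i=\begin{bmatrix}c_{11_i}&0\\0&c_{33_i}\end{bmatrix},\quad B_i=\begin{bmatrix}c_{33_i}&0\\0&c_{22_i}\end{bmatrix},\quad C_i=\begin{bmatrix}0&c_{12_i}\\c_{33_i}&0\end{bmatrix}.$$ PML metric: $S_x=S_x(s)=1+\dfrac{\sigma}{\alpha+s}$, where $\sigma\ge0$ is the damping and $\alpha\ge0$ the complex frequency shift; $\widetilde k_x=k_x/S_x$. PML model (Laplace transform in $t$ with dual variable $s$, Fourier transform in $x$ with dual variable $k_x$): for $i=1,2$, $$\rho_i s^2\widetilde{\mathbf u}_i=-\widetilde k_x^2A_i\widetilde{\mathbf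 u}_i+B_i\frac{d^2\widetilde{\mathbf u}_i}{dy^2}+\mathbf{i}\widetilde k_x(C_i+C_i^T)\frac{d\widetilde{\mathbf u}_i}{dy},$$ with interface conditions at $y=0$: $\widetilde{\mathbf u}_1=\widetilde{\mathbf u}_2$ and $B_1\frac{d\widetilde{\mathbf u}_1}{dy}+\mathbf{i}\widetilde k_xC_1^T\widetilde{\mathbf u}_1=B_2\frac{d\widetilde{\mathbf u}_2}{dy}+\mathbf{i}\widetilde k_xC_2^T\widetilde{\mathbf u}_2$. For $\sigma=0$ one has $\widetilde k_x=k_x$ and this is the undamped problem. Characteristic function: for $s,k,\kappa\in\mathbb{C}$, $$\mathcal{P}_i(k,\kappa)=\frac{k^2A_i-\kappa^2B_i-\mathbf{i}k\kappa(C_i+C_i^T)}{\rho_i},\qquad F_i(s,k,\kappa)=\det\big(s^2I+\mathcal{P}_i(k,\kappa)\big).$$ No growing Cauchy modes: the PML Cauchy problem (constant-coefficient PML in the whole plane, no interface) for material $i$ has no temporally growing modes if there are no $(k_x,k_y)\in\mathbb{R}^2$ and $s$ with $\Re s>0$ such that $F_i(s,k_x/S_x(s),\mathbf{i}k_y)=0$. Roots: for $\Re s>0$ and $k=k_x\in\mathbb{R}$, or $k=\widetilde k_x$ under the assumption of no growing Cauchy modes, the equation $F_i(s,k,\kappa)=0$ has four roots $\kappa$ (with multiplicity): $\kappa_{i1}^-,\kappa_{i2}^-$ with negative real part and $\kappa_{i1}^+,\kappa_{i2}^+$ with positive real part. Let $\Phi_{1j}\in\mathbb{C}^2$ ($j=1,2$)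 be eigenvectors, i.e. nonzero solutions of $(s^2I+\mathcal{P}_1(k,\kappa_{1j}^-))\Phi_{1j}=0$, and $\Phi_{2j}$ nonzero solutions of $(s^2I+\mathcal{P}_2(k,\kappa_{2j}^+))\Phi_{2j}=0$ (for a double root with two-dimensional eigenspace the two eigenvectors are taken linearly independent), scaled so that they are homogeneous of degree zero in $(s,k)$. Interface matrix and determinant: $\mathcal{F}(s,k)=\det\mathcal{C}(s,k)$ where $\mathcal{C}(s,k)$ is the $4\times4$ matrix $$\mathcal{C}(s,k)=\begin{bmatrix}\Phi_{11}&\Phi_{12}&-\Phi_{21}&-\Phi_{22}\\(\kappa_{11}^-B_1+\mathbf{i}kC_1^T)\Phi_{11}&(\kappa_{12}^-B_1+\mathbf{i}kC_1^T)\Phi_{12}&-(\kappa_{21}^+B_2+\mathbf{i}kC_2^T)\Phi_{21}&-(\kappa_{22}^+B_2+\mathbf{i}kC_2^T)\Phi_{22}\end{bmatrix}.$$ Its null vectors give the modes decaying as $|y|\to\infty$: $\sum_j\delta_{1j}e^{\kappa_{1j}^-y}\Phi_{1j}$ for $y>0$ and $\sum_j\delta_{2j}e^{\kappa_{2j}^+y}\Phi_{2j}$ for $y<0$. *)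

(* Defs.v *)
From HB Require Import structures.
From mathcomp Require Import all_boot all_order all_algebra.
From mathcomp Require Import complex reals.

Set Implicit Arguments.
Unset Strict Implicit.
Unset Printing Implicit Defensive.

Import Order.TTheory GRing.Theory Num.Theory.
Local Open Scope ring_scope.
Local Open Scope complex_scope.

Record orthotropic (R : realType) := Orthotropic {
  rho : R;
  c11 : R;
  c22 : R;
  c33 : R;
  c12 : R;
  rho_gt0 : 0 < rho;
  c11_gt0 : 0 < c11;
  c22_gt0 : 0 < c22;
  c33_gt0 : 0 < c33;
  c12_lt : 0 < c11 * c22 - c12 ^+ 2
}.

Definition mx22 (R : realType) (a b c d : R[i]) : 'M[R[i]]_2 :=
  \matrix_(i < 2, j < 2)
    (if i == ord0 then if j == ord0 then a else b
                  else if j == ord0 then c else d).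

Section Elasticity.
Variables (R : realType) (m : orthotropic R).
Implicit Types s k kappa : R[i].

Definition mxA : 'M[R[i]]_2 := mx22 (c11 m)%:C 0 0 (c33 m)%:C.
Definition mxB : 'M[R[i]]_2 := mx22 (c33 m)%:C 0 0 (c22 m)%:C.
Definition mxC : 'M[R[i]]_2 := mx22 0 (c12 m)%:C (c33 m)%:C 0.

Definition symbolP k kappa : 'M[R[i]]_2 :=
  ((rho m)%:C)^-1 *:
    (k ^+ 2 *: mxA - kappa ^+ 2 *: mxB - ('i%C * k * kappa) *: (mxC + mxC^T)).

Definition mode_mx s k kappa : 'M[R[i]]_2 := (s ^+ 2)%:M + symbolP k kappa.

Definition charF s k kappa : R[i] := \det (mode_mx s k kappa).

(* [charF s k] is a quartic in kappa; the factorization records its four roots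
   with multiplicity. *)
Definition split_roots s k (km kp : 'I_2 -> R[i]) : Prop :=
  [/\ forall j, complex.Re (km j) < 0,
      forall j, 0 < complex.Re (kp j) &
      exists2 c : R[i], c != 0 &
        forall kappa, charF s k kappa =
          c * \prod_(j < 2) (kappa - km j) * \prod_(j < 2) (kappa - kp j)].

(* When the two roots coincide but the null space is a line, the two vectors
   are allowed (and forced) to be parallel. *)
Definition eigenvectors s k (kap : 'I_2 -> R[i]) (Phi : 'I_2 -> 'cV[R[i]]_2) :
    Prop :=
  [/\ forall j, Phi j != 0,
      forall j, mode_mx s k (kap j) *m Phi j = 0 &
      kap ord0 = kap ord_max ->
      \rank (cokermx (mode_mx s k (kap ord0))) = 2%N ->
      \rank (row_mx (Phi ord0) (Phi ord_max)) = 2%N].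

Definition traction_mx k kappa : 'M[R[i]]_2 := kappa *: mxB + ('i%C * k) *: mxC^T.

End Elasticity.

Definition pml_metric (R : realType) (sigma alpha : R) (s : R[i]) : R[i] :=
  1 + sigma%:C / (alpha%:C + s).

Definition pml_wavenumber (R : realType) (sigma alpha : R) (s : R[i]) (kx : R) :
    R[i] :=
  kx%:C / pml_metric sigma alpha s.

Definition no_growing_Cauchy_modes (R : realType) (sigma alpha : R)
    (m : orthotropic R) : Prop :=
  ~ exists (kx ky : R) (s : R[i]),
      0 < complex.Re s /\
      charF m s (pml_wavenumber sigma alpha s kx) ('i%C * ky%:C) = 0.

(* The pairs (s, k) at which the roots and eigenvectors of a layer are defined:
   k is real, or k is a PML wavenumber and the Cauchy problem of that layer has
   no growing modes. *)
Definition mode_domain (R : realType) (sigma alpha : R) (m : orthotropic R)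
    (s k : R[i]) : Prop :=
  0 < complex.Re s /\
  exists kx : R,
    k = kx%:C \/
    (no_growing_Cauchy_modes sigma alpha m /\
     k = pml_wavenumber sigma alpha s kx).

Definition root_family (R : realType) (sigma alpha : R) (m : orthotropic R)
    (km kp : R[i] -> R[i] -> 'I_2 -> R[i]) : Prop :=
  forall s k, mode_domain sigma alpha m s k ->
    split_roots m s k (km s k) (kp s k).

(* Homogeneity of degree zero is required only under real positive scalings
   that stay in the domain; a scaling by a complex factor could exchange the
   two half-planes containing the roots. *)
Definition eigenvector_family (R : realType) (sigma alpha : R)
    (m : orthotropic R) (kap : R[i] -> R[i] -> 'I_2 -> R[i])
    (Phi : R[i] -> R[i] -> 'I_2 -> 'cV[R[i]]_2) : Prop :=
  (forall s k, mode_domain sigma alpha m s k ->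
     eigenvectors m s k (kap s k) (Phi s k)) /\
  (forall (lambda : R) s k, 0 < lambda ->
     mode_domain sigma alpha m s k ->
     mode_domain sigma alpha m (lambda%:C * s) (lambda%:C * k) ->
     forall j, Phi (lambda%:C * s) (lambda%:C * k) j = Phi s k j).

Definition mx_of_cols (R : realType) (v : 'I_2 -> 'cV[R[i]]_2) : 'M[R[i]]_2 :=
  \matrix_(r < 2, j < 2) v j r ord0.

Definition interface_mx (R : realType) (m1 m2 : orthotropic R) (k : R[i])
    (kap1 kap2 : 'I_2 -> R[i]) (Phi1 Phi2 : 'I_2 -> 'cV[R[i]]_2) :
    'M[R[i]]_(2 + 2) :=
  block_mx
    (mx_of_cols Phi1)
    (- mx_of_cols Phi2)
    (mx_of_cols (fun j => traction_mx m1 k (kap1 j) *m Phi1 j))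
    (- mx_of_cols (fun j => traction_mx m2 k (kap2 j) *m Phi2 j)).

(* Modes decay as |y| tends to infinity: layer 1 fills y > 0 and uses its roots
   with negative real part, layer 2 fills y < 0 and uses those with positive
   real part. *)
Definition interface_det (R : realType) (m1 m2 : orthotropic R)
    (km1 kp2 : R[i] -> R[i] -> 'I_2 -> R[i])
    (Phi1 Phi2 : R[i] -> R[i] -> 'I_2 -> 'cV[R[i]]_2) (s k : R[i]) : R[i] :=
  \det (interface_mx m1 m2 k (km1 s k) (kp2 s k) (Phi1 s k) (Phi2 s k)).

(* Main.v *)
(* By homogeneity of the symbol, multiplication by S = S_x(s) carries the roots
   at (s, kx / S) to the roots at (s S, kx), with the same null vectors and with
   tractions multiplied by S; moreover Re (s S) > 0. The interface determinant
   at (s, kx / S) therefore vanishes only if the one at (s S, kx) does, provided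
   multiplication by the complex number S maps decaying roots to decaying roots.
   For a root mu at (s S, kx), neither Re mu nor Re (mu / S) vanishes, the former
   because the undamped problem has no imaginary root, the latter because there
   are no growing Cauchy modes. Along the line s_t = Re s + i t Im s the roots
   move continuously, so the signs of the two real parts never change; they agree
   at t = 0, where S is a positive real. *)
Require Import Defs.
From HB Require Import structures.
From mathcomp Require Import all_boot all_order all_algebra.
From mathcomp Require Import complex reals.
From mathcomp Require Import boolp classical_sets filter topology normedtype.
From mathcomp Require Import ring.

Set Implicit Arguments.
Unset Strict Implicit.
Unset Printing Implicit Defensive.

Import Order.TTheory GRing.Theory Num.Theory.
Import numFieldNormedType.Exports.
Local Open Scope classical_set_scope.
Local Open Scope ring_scope.
Local Open Scope complex_scope.

(** * Roots of a polynomial under perturbation of its coefficients *)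

(** Over a closed field [|q.[x]|] is [|lead_coef q|] times the product of the distances from [x] to
    the roots. If all these distances were at least [e], the product would be at least [e] to the
    degree. *)
Lemma root_near (K : numClosedFieldType) (q : {poly K}) (x e : K) :
    0 < e -> `|q.[x]| < `|lead_coef q| * e ^+ (size q).-1 ->
  exists2 z, root q z & `|z - x| < e.
Proof.
move=> e0 qx; have [r qE] := closed_field_poly_normal q.
have q0 : lead_coef q != 0.
  by apply: contraTneq qx => ->; rewrite normr0 mul0r normr_lt0.
have szq : (size q).-1 = size r.
  by rewrite [in LHS]qE size_scale // size_prod_XsubC.
have [/hasP[z zr zx]|/hasPn far] := boolP (has (fun z => `|z - x| < e) r).
  by exists z => //; rewrite qE rootZ // root_prod_XsubC.
suff /(lt_le_trans qx) : `|lead_coef q| * e ^+ (size q).-1 <= `|q.[x]|.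
  by rewrite ltxx.
rewrite szq [in leRHS]qE hornerZ normrM ler_wpM2l // horner_prod normr_prod.
have -> : e ^+ size r = \prod_(z <- r) e.
  by rewrite big_const_seq count_predT iter_mulr_1.
rewrite big_seq [leRHS]big_seq; apply: ler_prod => z zr; rewrite ltW //=.
by rewrite !hornerE distrC real_leNgt ?(gtr0_real e0) ?normr_real ?far.
Qed.

Definition biquadratic (K : nzRingType) (a b d : K) : {poly K} :=
  a *: 'X^4 + b *: 'X^2 + d%:P.

Lemma size_biquadratic (K : idomainType) (a b d : K) :
  a != 0 -> size (biquadratic a b d) = 5.
Proof.
move=> a0; rewrite /biquadratic -addrA size_polyDl ?size_scale ?size_polyXn //.
rewrite (leq_ltn_trans (size_polyD _ _)) // gtn_max size_polyC.
rewrite (leq_ltn_trans (size_scale_leq _ _)) ?size_polyXn //.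
by case: (d != 0).
Qed.

Lemma lead_coef_biquadratic (K : idomainType) (a b d : K) :
  a != 0 -> lead_coef (biquadratic a b d) = a.
Proof.
move=> a0; rewrite lead_coefE size_biquadratic // /biquadratic.
by rewrite !coefD !coefZ !coefXn coefC /= mulr1 mulr0 !addr0.
Qed.

Lemma horner_biquadratic (K : comNzRingType) (a b d x : K) :
  (biquadratic a b d).[x] = a * x ^+ 4 + b * x ^+ 2 + d.
Proof. by rewrite /biquadratic !hornerE. Qed.

(** Cauchy's bound in the variable [x ^+ 2]. When [|x| > 1], compare [a * x ^+ 4] with
    [- (b * x ^+ 2 + d)], use [|d| <= |d| * |x| ^+ 2] and divide by [|x| ^+ 2]. *)
Lemma root_biquadratic_bound (K : numFieldType) (a b d x : K) : a != 0 ->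
  root (biquadratic a b d) x -> `|x| ^+ 2 <= 1 + (`|b| + `|d|) / `|a|.
Proof.
move=> a0; rewrite rootE horner_biquadratic => /eqP fx.
have a_gt0 : 0 < `|a| by rewrite normr_gt0.
have bd0 : 0 <= (`|b| + `|d|) / `|a| by rewrite divr_ge0 // addr_ge0.
have [x1|x1] := real_leP (real1 K) (normr_real x); last first.
  by rewrite (@le_trans _ _ 1) ?lerDl // expr_le1 // ltW.
rewrite -[leLHS]add0r lerD // ler_pdivlMr // mulrC.
have x2 : 1 <= `|x| ^+ 2 by rewrite exprn_ege1.
rewrite -(ler_pM2r (lt_le_trans ltr01 x2)).
have -> : `|a| * `|x| ^+ 2 * `|x| ^+ 2 = `|b * x ^+ 2 + d|.
  rewrite -mulrA -exprD -normrX -normrM -normrN.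
  by congr `|_|; apply/eqP; rewrite eq_sym -subr_eq0 opprK addrC addrA fx.
apply: le_trans (ler_normD _ _) _; rewrite normrM normrX mulrDl lerD2l.
by rewrite ler_peMr.
Qed.

(** Finitely many points admit one radius, the minimum of theirs. It is fixed before [t], so that it
    can enter the smallness conditions imposed on [t] later. *)
Lemma near_roots_pos (K : numFieldType) (T : topologicalType) (t0 : T)
    (r : seq K) (g : T -> K -> K) :
    (forall x0, x0 \in r -> \forall y \near (t0, x0), 0 < g y.1 y.2) ->
  exists2 e : K, 0 < e &
    \forall t \near t0, forall x0 x, x0 \in r -> `|x0 - x| < e -> 0 < g t x.
Proof.
elim: r => [|z r IH] gr; first by exists 1 => //; near=> t.
have [x xr|e e0 He] := IH; first by apply: gr; rewrite inE xr orbT.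
have /gr : z \in z :: r by rewrite inE eqxx.
case=> -[A B] /= [A0 /nbhs_ballP[e' /= e'0 Be']] AB.
exists (Num.min e e').
  by rewrite comparable_lt_min ?real_comparable ?gtr0_real // e0.
near=> t.
have tA : A t by near: t.
have te : forall x0 x, x0 \in r -> `|x0 - x| < e -> 0 < g t x by near: t.
move=> x0 x; rewrite inE comparable_lt_min ?real_comparable ?gtr0_real //.
case/orP=> [/eqP->|xr] /andP[? ?]; last exact: te xr _.
by apply: (AB (t, x)); split => //; apply: Be'.
Unshelve. all: by end_near. Qed.

Lemma real_close_gt0 (K : numDomainType) (u v : K) :
    u \is Num.real -> v \is Num.real -> `|u - v| < `|u| ->
  (0 < v) = (0 < u).
Proof.
move=> uR vR; rewrite real_ltr_norml ?rpredB // => /andP[].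
have [u0|u0|->] := real_ltgt0P uR.
- by rewrite ltrBlDr ltrDl.
- by rewrite opprK ltrBrDl gtrDr => /lt_gtF.
- by rewrite oppr0 => /lt_trans/[apply]; rewrite ltxx.
Qed.

(** The constant leading coefficient [a] prevents roots from escaping to infinity. [root_near] is
    used in both directions: a bad root at [t0] has a root of [p t] close to it, and every root of
    [p t] is close to one of [p t0]. Since [g] is real, continuous and nonzero at the roots for
    [t0], its sign is the same at close points. *)
Lemma roots_pos_locally_constant (K : numClosedFieldType) (T : topologicalType)
    (t0 : T) (a : K) (b d : T -> K) (g : T -> K -> K)
    (p := fun t => biquadratic a (b t) (d t)) :
    a != 0 -> {for t0, continuous b} -> {for t0, continuous d} ->
    (forall x, {for (t0, x), continuous (fun y : T * K => g y.1 y.2)}) ->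
    (forall t x, g t x \is Num.real) ->
    (forall x, root (p t0) x -> g t0 x != 0) ->
  \forall t \near t0, (forall x, root (p t) x -> 0 < g t x) <->
                      (forall x, root (p t0) x -> 0 < g t0 x).
Proof.
move=> a0 cb cd cg gR g0.
have a_gt0 : 0 < `|a| by rewrite normr_gt0.
have gsign x : root (p t0) x ->
    \forall y \near (t0, x), (0 < g y.1 y.2) = (0 < g t0 x).
  move=> /g0; rewrite -normr_gt0 => gx0; have /cvgrPdist_lt/(_ _ gx0) := cg x.
  by apply: filterS => y /=; apply: real_close_gt0.
have [good|bad] := pselect (forall x, root (p t0) x -> 0 < g t0 x); last first.
  have [x0 /not_implyP[x0r g_le0]] :
      exists x0, ~ (root (p t0) x0 -> 0 < g t0 x0).
    exact/existsNP.
  have [[A B] /= [A0 /nbhs_ballP[e /= e0 Be]] AB] := gsign x0 x0r.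
  have ae0 : 0 < `|a| * e ^+ 4 by rewrite mulr_gt0 // exprn_gt0.
  have cp : {for t0, continuous (fun t => (p t).[x0])}.
    rewrite (_ : (fun t => _) = fun t => a * x0 ^+ 4 + b t * x0 ^+ 2 + d t).
      apply: cvgD => //; apply: cvgD; first exact: cvg_cst.
      by apply: cvgM => //; exact: cvg_cst.
    by apply/funext => t; rewrite horner_biquadratic.
  (* The right side fails at [t0], so only the left side has to be refuted: some root [z] of [p t]
     close to [x0] gives [g] the sign it has at [x0]. *)
  near=> t; split => // good_t; exfalso; apply: g_le0.
  have [||z zr zx] := @root_near _ (p t) x0 e => //.
    rewrite lead_coef_biquadratic // size_biquadratic //=.
    rewrite -normrN -[X in `|X|]add0r -(eqP x0r); near: t.
    by move/cvgrPdist_lt : cp => /(_ _ ae0).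
  have /AB /= <- : (A `*` B) (t, z).
    split=> /=; first by near: t.
    by apply: Be; rewrite /ball/= distrC.
  exact: good_t.
have [r pE] := closed_field_poly_normal (p t0).
have lead0 : lead_coef (p t0) != 0 by rewrite lead_coef_biquadratic.
have rE x : root (p t0) x = (x \in r) by rewrite pE rootZ // root_prod_XsubC.
have [x0|e e0 gpos] := @near_roots_pos _ _ t0 r g.
  rewrite -rE => x0r; apply: filterS (gsign _ x0r) => y ->; exact: good.
(* [M] bounds [|x| ^+ 2] for all roots [x] of [p t], once both coefficients are within 1 of their
   values at [t0]. *)
pose M := 1 + (`|b t0| + 1 + (`|d t0| + 1)) / `|a|.
have M0 : 0 < M by rewrite ltr_pwDl ?divr_ge0 ?addr_ge0.
(* The threshold of [root_near] in degree four, later split evenly between the variations of [b] and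
   [d]. *)
pose eta := `|a| * e ^+ 4.
have eta0 : 0 < eta by rewrite mulr_gt0 // exprn_gt0.
have eta2 : 0 < eta / 2 by rewrite divr_gt0.
near=> t; split => // _ x xr.
have bt1 : `|b t0 - b t| < 1 by near: t; move/cvgrPdist_lt : cb => /(_ _ ltr01).
have dt1 : `|d t0 - d t| < 1 by near: t; move/cvgrPdist_lt : cd => /(_ _ ltr01).
have bt : `|b t0 - b t| < eta / 2 / M.
  by near: t; move/cvgrPdist_lt : cb => /(_ _ (divr_gt0 eta2 M0)).
have dt : `|d t0 - d t| < eta / 2.
  by near: t; move/cvgrPdist_lt : cd => /(_ _ eta2).
have xM : `|x| ^+ 2 <= M.
  have le1 (u v : K) : `|u - v| < 1 -> `|v| <= `|u| + 1.
    move=> uv; rewrite -[v in leLHS](subKr u) (le_trans (ler_normB _ _)) //.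
    by rewrite lerD2l ltW.
  apply: le_trans (root_biquadratic_bound a0 xr) _.
  by rewrite lerD2l ler_pM2r ?invr_gt0 // lerD // le1.
have [|z zr zx] := @root_near _ (p t0) x e e0; last first.
  suff gp : forall x0 x, x0 \in r -> `|x0 - x| < e -> 0 < g t x.
    by apply: gp zx; rewrite -rE.
  by near: t.
rewrite lead_coef_biquadratic // size_biquadratic //= -/eta.
(* Subtracting [(p t).[x] = 0] cancels the quartic term. *)
have -> : (p t0).[x] = (b t0 - b t) * x ^+ 2 + (d t0 - d t).
  rewrite -[LHS]subr0 -(eqP xr) !horner_biquadratic; ring.
rewrite (le_lt_trans (ler_normD _ _)) // (splitr eta) ler_ltD //.
rewrite normrM normrX -[leRHS](divfK (lt0r_neq0 M0)).
by rewrite ler_pM // ?exprn_ge0 // ltW.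
Unshelve. all: by end_near. Qed.

Lemma Re_continuous (K : numClosedFieldType) : continuous (fun x : K => 'Re x).
Proof.
move=> x; apply/(@cvgrPdist_lt _ _ _ _ (nbhs_filter x)) => e e0.
apply/nbhs_ballP; exists e => //= y xy.
by rewrite -raddfB (le_lt_trans _ xy) // leif_normC_Re_Creal.
Qed.

(** The choice of [g] is a product that is positive exactly when both real parts are nonzero with
    equal signs. The coefficients have the shape of those in [charF_biquadratic] at frequency [z t],
    the fixed wavenumber being absorbed in [b1], [d0] and [d1]. *)
Lemma aligned_locally_constant (K : numClosedFieldType) (T : topologicalType)
    (t0 : T) (u : T -> K) (sigma alpha a b0 b1 d0 d1 : K)
    (S := fun t => 1 + sigma / (alpha + u t)) (z := fun t => u t * S t)
    (p := fun t => biquadratic a (b0 * z t ^+ 2 + b1)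
                                 ((z t ^+ 2 + d0) * (z t ^+ 2 + d1))) :
    a != 0 -> (forall e : K, 0 < e -> \forall t \near t0, `|u t0 - u t| < e) ->
    alpha + u t0 != 0 -> S t0 != 0 ->
    (forall x, root (p t0) x -> 'Re x * 'Re (x / S t0) != 0) ->
  \forall t \near t0,
    (forall x, root (p t) x -> 0 < 'Re x * 'Re (x / S t)) <->
    (forall x, root (p t0) x -> 0 < 'Re x * 'Re (x / S t0)).
Proof.
move=> a0 cu au0 S0 nz.
have cu' : u @ t0 --> u t0 by apply/cvgrPdist_lt.
have cS : S @ t0 --> S t0.
  apply: cvgD; first exact: cvg_cst.
  apply: cvgM; first exact: cvg_cst.
  by apply: cvgV => //; apply: cvgD => //; exact: cvg_cst.
have cz : z @ t0 --> z t0 by exact: cvgM.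
have cz2 : (fun t => z t ^+ 2) @ t0 --> z t0 ^+ 2.
  by rewrite expr2; under eq_fun do rewrite expr2; exact: cvgM.
apply: (@roots_pos_locally_constant _ _ _ a (fun t => b0 * z t ^+ 2 + b1)
  (fun t => (z t ^+ 2 + d0) * (z t ^+ 2 + d1))
  (fun t x => 'Re x * 'Re (x / S t))) => //.
- by apply: cvgD; [apply: cvgM => //; exact: cvg_cst|exact: cvg_cst].
- by apply: cvgM; apply: cvgD => //; exact: cvg_cst.
- move=> x /=; apply: cvgM.
    apply: (@cvg_comp _ _ _ snd (fun x : K => 'Re x)); first exact: cvg_snd.
    exact: Re_continuous.
  apply: (@cvg_comp _ _ _ (fun y : T * K => y.2 / S y.1) (fun x : K => 'Re x));
    last exact: Re_continuous.
  apply: cvgM; first exact: cvg_snd.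
  apply: cvgV => //; apply: (@cvg_comp _ _ _ fst S); last exact: cS.
  exact: cvg_fst.
- by move=> t x; rewrite rpredM // Creal_Re.
Qed.

(** * The characteristic function: homogeneity and form in kappa *)

Lemma det_mx22 (R : realType) (a b c d : R[i]) :
  \det (mx22 a b c d) = a * d - b * c.
Proof.
rewrite (expand_det_row _ ord0) !big_ord_recl big_ord0 /cofactor !det_mx11.
by rewrite !mxE /= addr0 expr0 expr1 mul1r mulN1r mulrN.
Qed.

Section Layer.
Variables (R : realType) (m : orthotropic R).
Implicit Types s k kappa : R[i].

Lemma mode_mxE s k kappa : mode_mx m s k kappa =
  mx22 (s ^+ 2 + ((c11 m)%:C * k ^+ 2 - (c33 m)%:C * kappa ^+ 2) / (rho m)%:C)
       (- ('i%C * k * kappa * ((c12 m)%:C + (c33 m)%:C) / (rho m)%:C))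
       (- ('i%C * k * kappa * ((c12 m)%:C + (c33 m)%:C) / (rho m)%:C))
       (s ^+ 2 + ((c33 m)%:C * k ^+ 2 - (c22 m)%:C * kappa ^+ 2) / (rho m)%:C).
Proof.
apply/matrixP => i j; rewrite !mxE.
case: i j => [[|[|//]] ?] [[|[|//]] ?];
  rewrite /= ?mulr1n ?mulr0n; ring.
Qed.

Lemma mode_mx_scale (l s k kappa : R[i]) :
  mode_mx m (l * s) (l * k) (l * kappa) = l ^+ 2 *: mode_mx m s k kappa.
Proof.
rewrite !mode_mxE; apply/matrixP => i j.
by case: i j => [[|[|//]] ?] [[|[|//]] ?]; rewrite !mxE /=; ring.
Qed.

Lemma charF_scale (l s k kappa : R[i]) :
  charF m (l * s) (l * k) (l * kappa) = l ^+ 4 * charF m s k kappa.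
Proof. by rewrite /charF mode_mx_scale detZ -exprM. Qed.

(** The coefficient of [kappa ^+ 4]. It is independent of [s] and [k], so the degree never drops
    along a path. *)
Definition charF_lead : R[i] := (c33 m)%:C * (c22 m)%:C / (rho m)%:C ^+ 2.

Lemma charF_lead_neq0 : charF_lead != 0.
Proof.
rewrite /charF_lead -rmorphM -rmorphXn -fmorph_div fmorph_eq0 gt_eqF //.
by rewrite divr_gt0 ?mulr_gt0 ?exprn_gt0 ?c33_gt0 ?c22_gt0 ?rho_gt0.
Qed.

(** The diagonal entries of [mode_mx] are even in [kappa]; the equal off-diagonal entries are odd
    and enter the determinant only as a square. Hence no odd power survives. *)
Lemma charF_biquadratic s k kappa (r := (rho m)%:C) :
  charF m s k kappa = (biquadratic charF_lead
    (- ((c33 m)%:C + (c22 m)%:C) / r * s ^+ 2 +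
       ((((c12 m)%:C + (c33 m)%:C) ^+ 2 - (c33 m)%:C ^+ 2 -
         (c11 m)%:C * (c22 m)%:C) / r ^+ 2 * k ^+ 2))
    ((s ^+ 2 + (c11 m)%:C / r * k ^+ 2) *
     (s ^+ 2 + (c33 m)%:C / r * k ^+ 2))).[kappa].
Proof.
rewrite horner_biquadratic /charF mode_mxE det_mx22 /charF_lead.
have r0 : r != 0 by rewrite /r fmorph_eq0 gt_eqF // rho_gt0.
have ii : 'i%C ^+ 2 = -1 :> R[i] by exact: sqr_i.
by field: ii.
Qed.
End Layer.

(** * The PML metric on the right half-plane *)

Section Metric.
Variables (R : realType) (sigma alpha : R).
Hypotheses (sigma_ge0 : 0 <= sigma) (alpha_ge0 : 0 <= alpha).
Implicit Types s : R[i].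

Lemma shift_neq0 s : 0 < complex.Re s -> alpha%:C + s != 0.
Proof.
case: s => a b /= a0; apply/eqP => -[/eqP]; rewrite gt_eqF //.
by rewrite ltr_wpDl.
Qed.

(** With [s = a + ib], the product is [s] plus [sigma / N] times [s * cj], where [cj] is the
    conjugate of [alpha + s] and [N] its squared modulus. The real part of [s * cj] is
    [a * (alpha + a) + b ^+ 2], which is nonnegative. *)
Lemma Re_mul_pml_metric_gt0 s :
  0 < complex.Re s -> 0 < complex.Re (s * pml_metric sigma alpha s).
Proof.
move=> s0; have := shift_neq0 s0; case: s s0 => a b + as0.
rewrite [X in 0 < X -> _]/= => a0.
pose N := (alpha + a) ^+ 2 + b ^+ 2; pose cj : R[i] := (alpha + a) -i* b.
have N0 : 0 < N.
  by rewrite ltr_wpDr ?sqr_ge0 // exprn_gt0 // ltr_wpDl.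
have cjN : cj * (alpha%:C + (a +i* b)) = N%:C.
  by apply/eqP; rewrite eq_complex /=; apply/andP; split; apply/eqP;
     rewrite /N; ring.
have -> : (a +i* b) * pml_metric sigma alpha (a +i* b) =
   (a +i* b) + (sigma / N)%:C * ((a +i* b) * cj).
  rewrite /pml_metric mulrDr mulr1; congr (_ + _).
  rewrite mulrA; apply: (canLR (mulfK as0)).
  rewrite -[LHS]mulr1 (_ : 1 = N^-1%:C * (cj * (alpha%:C + (a +i* b)))).
    by rewrite rmorphM /=; ring.
  by rewrite cjN -rmorphM /= mulVf ?gt_eqF.
rewrite /= !mul0r !subr0 mulrN opprK ltr_pwDl // mulr_ge0 ?divr_ge0 ?(ltW N0) //.
by rewrite addr_ge0 -?expr2 ?sqr_ge0 // mulr_ge0 ?addr_ge0 // ltW.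
Qed.

Lemma pml_metric_neq0 s : 0 < complex.Re s -> pml_metric sigma alpha s != 0.
Proof.
move=> /Re_mul_pml_metric_gt0; apply: contraTneq => ->.
by rewrite mulr0 ltxx.
Qed.

End Metric.

(** * Sign agreement by continuation in the frequency *)

(** The set of parameters with sign agreement is open and closed in the connected line [R] and
    contains 0, hence contains 1. *)
Lemma pml_aligned (R : realType) (sigma alpha : R) (m : orthotropic R)
    (s : R[i]) (kx : R) (S := pml_metric sigma alpha) :
    0 <= sigma -> 0 <= alpha -> 0 < complex.Re s ->
    no_growing_Cauchy_modes sigma alpha m ->
    (forall z mu, 0 < complex.Re z -> charF m z kx%:C mu = 0 ->
       complex.Re mu != 0) ->
  forall mu, charF m (s * S s) kx%:C mu = 0 ->
    0 < complex.Re mu * complex.Re (mu / S s).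
Proof.
move=> sigma_ge0 alpha_ge0 s0 cauchy undamped.
(* [u 0] is real, [u 1] is [s], and the real part stays positive throughout. *)
pose u (t : R) : R[i] := complex.Re s +i* (t * complex.Im s).
have u0 t : 0 < complex.Re (u t) by [].
have Su t : S (u t) != 0 by exact: pml_metric_neq0.
have nz t mu : charF m (u t * S (u t)) kx%:C mu = 0 ->
    complex.Re mu * complex.Re (mu / S (u t)) != 0.
  move=> F0; rewrite mulf_neq0 //.
    by apply: undamped F0; apply: Re_mul_pml_metric_gt0.
  (* If [mu / S (u t)] were purely imaginary, its imaginary part would serve as [ky]: homogeneity
     turns [mu] into a growing Cauchy mode at frequency [u t]. *)
  apply/eqP => Re0; apply: cauchy.
  exists kx, (complex.Im (mu / S (u t))), (u t); split; first exact: u0.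
  apply: (mulfI (expf_neq0 4 (Su t))); rewrite mulr0 -charF_scale -[RHS]F0.
  congr charF; first exact: mulrC.
    by rewrite /pml_wavenumber mulrC divfK.
  rewrite -[in RHS](divfK (Su t) mu) [RHS]mulrC; congr (_ * _).
  by rewrite [RHS]complexE Re0 add0r.
pose al t := forall mu, charF m (u t * S (u t)) kx%:C mu = 0 ->
  0 < complex.Re mu * complex.Re (mu / S (u t)).
(* ['Re] takes values in [R[i]] and [complex.Re] in [R]; this translates between the two. *)
have ReM (x y : R[i]) : 'Re x * 'Re y = (complex.Re x * complex.Re y)%:C.
  by rewrite -!complexRe rmorphM.
have loc t0 : \forall t \near t0, al t <-> al t0.
  pose r := (rho m)%:C.
  have := @aligned_locally_constant R[i] R t0 u sigma%:C alpha%:C (charF_lead m)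
    (- ((c33 m)%:C + (c22 m)%:C) / r)
    ((((c12 m)%:C + (c33 m)%:C) ^+ 2 - (c33 m)%:C ^+ 2 -
      (c11 m)%:C * (c22 m)%:C) / r ^+ 2 * kx%:C ^+ 2)
    ((c11 m)%:C / r * kx%:C ^+ 2) ((c33 m)%:C / r * kx%:C ^+ 2).
  case=> //.
  - exact: charF_lead_neq0.
  (* A positive [e] in [R[i]] is real, and [u] varies only in its imaginary part, so the estimate
     reduces to one in [R]. *)
  - move=> e e0; have Re_e : 0 < complex.Re e.
      by move: e0; rewrite ltcE /= => /andP[].
    have : (fun t => t * complex.Im s) @ t0 --> t0 * complex.Im s.
      by apply: cvgM => //; exact: cvg_cst.
    move=> /cvgrPdist_lt/(_ _ Re_e); apply: filterS => t ut.
    rewrite normc_def ltcE /=.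
    rewrite subrr expr0n add0r sqrtr_sqr.
    by move: e0; rewrite ltcE /= => /andP[-> _].
  - exact: shift_neq0.
  - exact: Su.
  - move=> x; rewrite rootE -charF_biquadratic ReM => /eqP /nz.
    by apply: contra_neq => -[].
  move=> A [A0 At]; exists A => // t /At [H1 H2].
  split=> H mu F0; rewrite -ltcR -ReM; [apply: H1|apply: H2] => [x||x|].
  - by rewrite rootE -charF_biquadratic => /eqP /H; rewrite ReM ltcR.
  - by rewrite rootE -charF_biquadratic F0.
  - by rewrite rootE -charF_biquadratic => /eqP /H; rewrite ReM ltcR.
  - by rewrite rootE -charF_biquadratic F0.
have al0 : al 0.
  (* At parameter 0 the metric is a positive real, so the product is the square of [complex.Re mu]
     divided by it; [nz] makes it nonzero. *)
  have a0 : 0 < 1 + sigma / (alpha + complex.Re s).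
    by rewrite ltr_pwDl // divr_ge0 // addr_ge0 // ltW.
  have S0 : S (u 0) = (1 + sigma / (alpha + complex.Re s))%:C.
    by rewrite /S /pml_metric /u mul0r rmorphD rmorph1 fmorph_div rmorphD.
  move=> mu /nz; rewrite S0; case: mu => x y.
  rewrite -fmorphV /= mulr0 subr0 => xx0.
  rewrite lt_def xx0 mulrA mulr_ge0 ?invr_ge0 ?(ltW a0) // -expr2.
  exact: sqr_ge0.
(* The equivalence [loc] makes both the set and its complement open. *)
have alT : [set t | al t] = setT.
  have /connected_intervalP cT : is_interval (@setT R) by [].
  have al_open : open [set t | al t].
    rewrite openE => t /= alt; apply: filterS (loc t) => t'; tauto.
  apply: (cT [set t | al t]).
  - by exists 0; exact: al0.
  - by exists [set t | al t]; rewrite ?setTI.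
  exists [set t | al t]; rewrite ?setTI // -openC openE => t /= alt.
  by apply: filterS (loc t) => t' /=; tauto.
have : [set t | al t] 1 by rewrite alT.
by rewrite /= /al /u mul1r; case: (s).
Qed.

(** * Roots in a half-plane and their behaviour under complex scaling *)

Section HalfPlaneRoots.
Variables (R : realType) (m : orthotropic R).
Implicit Types (s k l : R[i]) (kap : 'I_2 -> R[i]).

(* [e] is 1 or -1 and selects the half-plane. *)
Definition half_plane_roots s k (e : R) kap :=
  (forall i, charF m s k (kap i) = 0 /\ 0 < e * complex.Re (kap i)) /\
  (forall kappa, charF m s k kappa = 0 -> 0 < e * complex.Re kappa ->
     exists i, kappa = kap i).

(** Multiplicities are forgotten here. The double root with a two-dimensional null space is
    recovered by [mode_mx_eq0_roots]. *)
Lemma split_roots_half_plane s k km kp : split_roots m s k km kp ->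
  half_plane_roots s k (-1) km /\ half_plane_roots s k 1 kp.
Proof.
case=> km0 kp0 [c c0 F].
have rootP kappa : charF m s k kappa = 0 ->
    (exists i, kappa = km i) \/ (exists i, kappa = kp i).
  move=> /eqP; rewrite F !mulf_eq0 (negbTE c0) /=.
  by case/orP => /prodf_eq0[i _]; rewrite subr_eq0 => /eqP ->;
    [left|right]; exists i.
split; split.
- move=> i; rewrite mulN1r oppr_gt0; split=> //.
  by rewrite F (bigD1 i) //= subrr mul0r mulr0 mul0r.
- move=> kappa /rootP[//|[i ->]].
  by rewrite mulN1r oppr_gt0 => /lt_gtF; rewrite kp0.
- move=> i; rewrite mul1r; split=> //.
  by rewrite F [X in _ * X](bigD1 i) //= subrr mul0r mulr0.
- move=> kappa /rootP[[i ->]|//].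
  by rewrite mul1r => /lt_gtF; rewrite km0.
Qed.

Lemma charF_Re_neq0 s k km kp kappa : split_roots m s k km kp ->
  charF m s k kappa = 0 -> complex.Re kappa != 0.
Proof.
case=> km0 kp0 [c c0 F] /eqP; rewrite F !mulf_eq0 (negbTE c0) /=.
case/orP => /prodf_eq0[i _]; rewrite subr_eq0 => /eqP ->.
  by rewrite lt_eqF.
by rewrite gt_eqF.
Qed.

(** Dividing a scaled root by [l] gives a root at [(s, k)] by homogeneity, and the sign agreement
    keeps it in the half-plane selected by [e]. *)
Lemma half_plane_roots_scale s k l e kap kap' : l != 0 ->
    half_plane_roots s k e kap -> half_plane_roots (l * s) (l * k) e kap' ->
    (forall mu, charF m (l * s) (l * k) mu = 0 ->
       0 < complex.Re mu * complex.Re (mu / l)) ->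
  forall j, exists i, kap' j = l * kap i.
Proof.
move=> l0 [_ kapP] [kap'P _] al j; have [F0 e0] := kap'P j.
have lK : l * (kap' j / l) = kap' j by rewrite mulrC divfK.
have [||i kE] := kapP (kap' j / l); last by exists i; rewrite -kE lK.
  by apply: (mulfI (expf_neq0 4 l0)); rewrite -charF_scale lK F0 mulr0.
move: e0 (al _ F0); set a := complex.Re _; set b := complex.Re _ => e0 ab.
have a2 : 0 < a ^+ 2.
  by rewrite exprn_even_gt0 //; apply: contraTneq e0 => ->; rewrite mulr0 ltxx.
(* The sign of [e * b] is read off from [a ^+ 2 * (e * b) = (e * a) * (a * b)]. *)
rewrite -(pmulr_rgt0 _ a2).
rewrite (_ : a ^+ 2 * (e * b) = (e * a) * (a * b)); last by ring.
exact: mulr_gt0.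
Qed.

(** A zero off-diagonal entry at the nonzero root [x] forces [k * (c12 + c33) = 0], so the matrix is
    diagonal for every [kappa]. Its diagonal entries vanish at [x], hence are multiples of
    [y ^+ 2 - x ^+ 2], and [charF] is [charF_lead] times the square of that difference. Every root
    is thus [x] or [- x], and the half-plane excludes [- x]. *)
Lemma mode_mx_eq0_roots s k e kap i : half_plane_roots s k e kap ->
  mode_mx m s k (kap i) = 0 -> forall j, kap j = kap i.
Proof.
case=> kapP _ M0 j; have [_ ei] := kapP i; have [Fj ej] := kapP j.
set x := kap i in M0 ei *; set y := kap j in Fj ej *.
have x0 : x != 0 by apply: contraTneq ei => ->; rewrite mulr0 ltxx.
have [r0 c0 d0] : [/\ (rho m)%:C != 0, (c33 m)%:C != 0 & (c22 m)%:C != 0].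
  by rewrite !fmorph_eq0 !gt_eqF ?rho_gt0 ?c33_gt0 ?c22_gt0.
move: M0; rewrite mode_mxE => M0.
have := congr1 (fun M : 'M_2 => M ord0 ord0) M0.
have := congr1 (fun M : 'M_2 => M ord0 ord_max) M0.
have := congr1 (fun M : 'M_2 => M ord_max ord_max) M0.
rewrite !mxE /= => E11 E01 E00.
have kc : k * ((c12 m)%:C + (c33 m)%:C) = 0.
  have i0 : 'i%C != 0 :> R[i] by rewrite neq0Ci.
  apply/eqP; move/eqP: E01; rewrite oppr_eq0 !mulf_eq0 invr_eq0.
  by rewrite (negbTE i0) (negbTE x0) (negbTE r0) !orbF.
have : charF_lead m * (y ^+ 2 - x ^+ 2) ^+ 2 = 0.
  rewrite -Fj /charF mode_mxE det_mx22.
  have -> : 'i%C * k * y * ((c12 m)%:C + (c33 m)%:C) = 0.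
    transitivity ('i%C * y * (k * ((c12 m)%:C + (c33 m)%:C))); first by ring.
    by rewrite kc mulr0.
  rewrite mul0r oppr0 mulr0 subr0.
  rewrite -[X in _ = X * _](subr0) -[X in _ = (_ - X) * _]E00.
  rewrite -[X in _ = _ * X](subr0) -[X in _ = _ * (_ - X)]E11.
  by rewrite /charF_lead; field.
move/eqP; rewrite mulf_eq0 (negbTE (charF_lead_neq0 m)) expf_eq0 /= subr_eq0.
rewrite eqf_sqr => /orP[/eqP //|/eqP yE].
move: ej; rewrite yE raddfN mulrN oppr_gt0 => /lt_gtF; by rewrite ei.
Qed.

End HalfPlaneRoots.

(** * Comparison of the eigenvectors at the two scaled points *)

(** A nonzero matrix of order two has rank at least one, so its null space is the line through [x].
    Transposes appear because [kermx] is made of row vectors. *)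
Lemma null_vector_colinear (F : fieldType) (M : 'M[F]_2) (x y : 'cV[F]_2) :
  M != 0 -> x != 0 -> M *m x = 0 -> M *m y = 0 -> exists c, y = c *: x.
Proof.
move=> M0 x0 Mx My.
have kerP (z : 'cV_2) : M *m z = 0 -> (z^T <= kermx M^T)%MS.
  by move=> Mz; apply/sub_kermxP; rewrite -trmx_mul Mz trmx0.
have xker : (kermx M^T <= x^T)%MS.
  rewrite -(geq_leqif (mxrank_leqif_sup (kerP _ Mx))).
  rewrite mxrank_ker mxrank_tr rank_rV.
  by rewrite trmx_eq0 x0 leq_subLR addn1 ltnS lt0n mxrank_eq0.
have /sub_rVP[c yE] := submx_trans (kerP _ My) xker.
by exists c; apply: trmx_inj; rewrite yE linearZ.
Qed.

Section Columns.
Variables (R : realType) (m : orthotropic R).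
Implicit Types (s k l : R[i]) (kap : 'I_2 -> R[i]) (Phi : 'I_2 -> 'cV[R[i]]_2).

Lemma traction_mx_scale l k kappa :
  traction_mx m (l * k) (l * kappa) = l *: traction_mx m k kappa.
Proof. by rewrite /traction_mx scalerDr !scalerA [_ * (l * k)]mulrCA. Qed.

Lemma mx_of_colsE Phi : mx_of_cols Phi = row_mx (Phi ord0) (Phi ord_max).
Proof.
apply/matrixP => r j; rewrite !mxE.
by case: splitP => i ji; rewrite (ord1 i) in ji *;
  congr (Phi _ _ _); apply: val_inj.
Qed.

Lemma mx_of_cols_mul_cV Phi (v : 'cV_2) :
  mx_of_cols Phi *m v = \sum_i v i ord0 *: Phi i.
Proof.
apply/matrixP => r j; rewrite !mxE summxE; apply: eq_bigr => i _.
by rewrite !mxE mulrC (ord1 j).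
Qed.

Lemma mx_of_cols_mul Phi (G : 'M_2) :
  mx_of_cols Phi *m G = mx_of_cols (fun j => \sum_i G i j *: Phi i).
Proof.
apply/matrixP => r j; rewrite !mxE summxE; apply: eq_bigr => i _.
by rewrite !mxE mulrC.
Qed.

(* When [mode_mx] vanishes at a root, that root is double and its two
   eigenvectors form a basis; otherwise null spaces at the roots are lines. *)
Lemma eigenvectors_change_of_basis s k l e kap kap' Phi Phi' : l != 0 ->
    half_plane_roots m s k e kap -> eigenvectors m s k kap Phi ->
    eigenvectors m (l * s) (l * k) kap' Phi' ->
    (forall j, exists i, kap' j = l * kap i) ->
  exists G : 'M[R[i]]_2,
    mx_of_cols Phi' = mx_of_cols Phi *m G /\
    mx_of_cols (fun j => traction_mx m (l * k) (kap' j) *m Phi' j) =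
    l *: (mx_of_cols (fun j => traction_mx m k (kap j) *m Phi j) *m G).
Proof.
move=> l0 rootsP [Phi0 PhiE PhiB] [_ PhiE' _] kapE.
(* [v j] holds the coordinates of [Phi' j] on the vectors [Phi i]. The same coordinates serve the
   tractions because only vectors with equal [kap i] are ever combined. *)
have [v vP] : exists v : 'I_2 -> 'cV[R[i]]_2, forall j,
    Phi' j = \sum_i v j i ord0 *: Phi i /\
    traction_mx m (l * k) (kap' j) *m Phi' j =
    l *: \sum_i v j i ord0 *: (traction_mx m k (kap i) *m Phi i).
  apply: (fin_all_exists (P := fun j (w : 'cV[R[i]]_2) =>
    Phi' j = \sum_i w i ord0 *: Phi i /\
    traction_mx m (l * k) (kap' j) *m Phi' j =
    l *: \sum_i w i ord0 *: (traction_mx m k (kap i) *m Phi i))) => j.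
  have [i0 ki] := kapE j.
  have MPhi' : mode_mx m s k (kap i0) *m Phi' j = 0.
    have := PhiE' j; rewrite ki mode_mx_scale -scalemxAl => /eqP.
    by rewrite scaler_eq0 expf_eq0 (negbTE l0) /= => /eqP.
  have [M0|M0] := eqVneq (mode_mx m s k (kap i0)) 0.
    have kap_eq := mode_mx_eq0_roots rootsP M0.
    have rk : \rank (mx_of_cols Phi) = 2%N.
      rewrite mx_of_colsE; apply: PhiB; first by rewrite !kap_eq.
      by rewrite kap_eq M0 mxrank_coker mxrank0.
    have U : mx_of_cols Phi \in unitmx.
      by rewrite -row_full_unit /row_full rk.
    have PE : Phi' j =
        \sum_i (invmx (mx_of_cols Phi) *m Phi' j) i ord0 *: Phi i.
      by rewrite -mx_of_cols_mul_cV mulKVmx.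
    exists (invmx (mx_of_cols Phi) *m Phi' j); split => //.
    rewrite ki traction_mx_scale -scalemxAl; congr (_ *: _).
    rewrite [in LHS]PE mulmx_sumr; apply: eq_bigr => i _.
    by rewrite kap_eq scalemxAr.
  have [c ->] := null_vector_colinear M0 (Phi0 i0) (PhiE i0) MPhi'.
  exists (c *: delta_mx i0 ord0).
  have sumE (f : 'I_2 -> 'cV[R[i]]_2) :
      \sum_i (c *: delta_mx i0 ord0 : 'cV_2) i ord0 *: f i = c *: f i0.
    rewrite (bigD1 i0) //= big1 => [|i /negbTE i_i0].
      by rewrite !mxE !eqxx mulr1 addr0.
    by rewrite !mxE i_i0 mulr0 scale0r.
  by rewrite !sumE ki traction_mx_scale -scalemxAl -scalemxAr.
exists (\matrix_(i, j) v j i ord0).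
rewrite !mx_of_cols_mul; split.
  apply/matrixP => r j; rewrite !mxE (vP j).1; congr (fun_of_matrix _ _ _).
  by apply: eq_bigr => i _; rewrite mxE.
apply/matrixP => r j; rewrite mxE (vP j).2 !mxE.
congr (_ * fun_of_matrix _ _ _).
by apply: eq_bigr => i _; rewrite mxE.
Qed.

End Columns.

(** * The interface determinant under scaling *)

(** The new matrix is the old one multiplied by diag(1, l) on the left, in blocks of order two, and
    by diag(G1, G2) on the right. A zero of the determinant at [k] forces one at [k'], whatever [G1]
    and [G2] are. *)
Lemma interface_mx_det_scale (R : realType) (m1 m2 : orthotropic R)
    (l k k' : R[i]) (kap1 kap1' kap2 kap2' : 'I_2 -> R[i])
    (Phi1 Phi1' Phi2 Phi2' : 'I_2 -> 'cV[R[i]]_2) (G1 G2 : 'M[R[i]]_2) :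
    mx_of_cols Phi1' = mx_of_cols Phi1 *m G1 ->
    mx_of_cols Phi2' = mx_of_cols Phi2 *m G2 ->
    mx_of_cols (fun j => traction_mx m1 k' (kap1' j) *m Phi1' j) =
    l *: (mx_of_cols (fun j => traction_mx m1 k (kap1 j) *m Phi1 j) *m G1) ->
    mx_of_cols (fun j => traction_mx m2 k' (kap2' j) *m Phi2' j) =
    l *: (mx_of_cols (fun j => traction_mx m2 k (kap2 j) *m Phi2 j) *m G2) ->
  \det (interface_mx m1 m2 k' kap1' kap2' Phi1' Phi2') =
  l ^+ 2 * \det (interface_mx m1 m2 k kap1 kap2 Phi1 Phi2) *
  (\det G1 * \det G2).
Proof.
move=> P1 P2 T1 T2.
have -> : interface_mx m1 m2 k' kap1' kap2' Phi1' Phi2' =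
    block_mx 1%:M 0 0 l%:M *m interface_mx m1 m2 k kap1 kap2 Phi1 Phi2 *m
    block_mx G1 0 0 G2.
  rewrite /interface_mx P1 P2 T1 T2 !mulmx_block !mul1mx !mul0mx !mulmx0.
  by rewrite !add0r !addr0 !mul_scalar_mx -!scalemxAl !mulNmx scalerN.
by rewrite !det_mulmx !det_ublock det1 mul1r det_scalar.
Qed.

Theorem theorem5 (R : realType) (sigma alpha : R) (m1 m2 : orthotropic R)
  (km1 kp1 km2 kp2 : R[i] -> R[i] -> 'I_2 -> R[i])
  (Phi1 Phi2 : R[i] -> R[i] -> 'I_2 -> 'cV[R[i]]_2)
  (sigma_ge0 : 0 <= sigma) (alpha_ge0 : 0 <= alpha)
  (roots1 : root_family sigma alpha m1 km1 kp1)
  (roots2 : root_family sigma alpha m2 km2 kp2)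
  (modes1 : eigenvector_family sigma alpha m1 km1 Phi1)
  (modes2 : eigenvector_family sigma alpha m2 kp2 Phi2)
  (no_growing_interface_modes : forall (s : R[i]) (kx : R), 0 < complex.Re s ->
     interface_det m1 m2 km1 kp2 Phi1 Phi2 s kx%:C != 0)
  (no_growing_Cauchy1 : no_growing_Cauchy_modes sigma alpha m1)
  (no_growing_Cauchy2 : no_growing_Cauchy_modes sigma alpha m2) :
  forall (s : R[i]) (kx : R), 0 < complex.Re s ->
    interface_det m1 m2 km1 kp2 Phi1 Phi2 s
      (pml_wavenumber sigma alpha s kx) != 0.
Proof.
move=> s kx s0.
have sS0 := Re_mul_pml_metric_gt0 sigma_ge0 alpha_ge0 s0.
have l0 := pml_metric_neq0 sigma_ge0 alpha_ge0 s0.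
have al1 := pml_aligned (kx := kx) sigma_ge0 alpha_ge0 s0 no_growing_Cauchy1.
have al2 := pml_aligned (kx := kx) sigma_ge0 alpha_ge0 s0 no_growing_Cauchy2.
have real_dom m z : 0 < complex.Re z -> mode_domain sigma alpha m z kx%:C.
  by move=> z0; split=> //; exists kx; left.
have pml_dom m : no_growing_Cauchy_modes sigma alpha m ->
    mode_domain sigma alpha m s (pml_wavenumber sigma alpha s kx).
  by move=> c; split=> //; exists kx; right.
have kE : kx%:C = pml_metric sigma alpha s * pml_wavenumber sigma alpha s kx.
  by rewrite /pml_wavenumber mulrC divfK.
move: (no_growing_interface_modes _ kx sS0); rewrite /interface_det.
set l := pml_metric _ _ _ in sS0 l0 al1 al2 kE *.
set k := pml_wavenumber _ _ _ _ in pml_dom kE *.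
(* At a real wavenumber [split_roots] puts every root strictly in one of the half-planes, which
   rules out imaginary roots of the undamped problem. *)
have {}al1 := al1 (fun z mu z0 =>
  charF_Re_neq0 (roots1 _ _ (real_dom m1 z z0)) (kappa := mu)).
have {}al2 := al2 (fun z mu z0 =>
  charF_Re_neq0 (roots2 _ _ (real_dom m2 z z0)) (kappa := mu)).
have [h1 _] := split_roots_half_plane
  (roots1 _ _ (pml_dom m1 no_growing_Cauchy1)).
have [_ h2] := split_roots_half_plane
  (roots2 _ _ (pml_dom m2 no_growing_Cauchy2)).
have [h1' _] := split_roots_half_plane (roots1 _ _ (real_dom m1 _ sS0)).
have [_ h2'] := split_roots_half_plane (roots2 _ _ (real_dom m2 _ sS0)).
have e1 := modes1.1 _ _ (pml_dom m1 no_growing_Cauchy1).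
have e2 := modes2.1 _ _ (pml_dom m2 no_growing_Cauchy2).
have e1' := modes1.1 _ _ (real_dom m1 _ sS0).
have e2' := modes2.1 _ _ (real_dom m2 _ sS0).
(* The undamped point becomes [(l * s, l * k)], the form required by the scaling lemmas. *)
rewrite (mulrC s) kE in h1' h2' e1' e2' al1 al2 *.
have [G1 [P1 T1]] := eigenvectors_change_of_basis l0 h1 e1 e1'
  (half_plane_roots_scale l0 h1 h1' al1).
have [G2 [P2 T2]] := eigenvectors_change_of_basis l0 h2 e2 e2'
  (half_plane_roots_scale l0 h2 h2' al2).
rewrite (interface_mx_det_scale P1 P2 T1 T2).
by apply: contraNN => /eqP ->; rewrite mulr0 mul0r.
Qed.
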